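(* Let $r$, $k$ be positive integers such that $r$ is even, $k$ is odd, and \[ 1\le k\le \frac{r}{2}-1. \] Then there exists a simple $r$-regular graph $G$ that has no $\{k,r-k\}$-factor.
   Context: Graphs are finite and simple (no loops or multiple edges). For a set $H$ of integers, an $H$-factor of a graph $G$ is a spanning subgraph $F$ of $G$ (that is, $F$ has the same vertex set as $G$ and its edge set is a subset of that of $G$) such that the degree in $F$ of every vertex belongs to $H$. Thus a $\{k,r-k\}$-factor is a spanning subgraph in which every vertex has degree $k$ or $r-k$. A graph is $r$-regular if every vertex has degree $r$. *)

(* Defs.v *)
From mathcomp Require Import all_boot.
Set Implicit Arguments.
Unset Strict Implicit.
Unset Printing Implicit Defensive.

Record sgraph (V : finType) := SGraph {
  adj :> rel V;
  adj_sym : symmetric adj;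
  adj_irr : irreflexive adj
}.

Definition degree (V : finType) (G : sgraph V) (x : V) : nat :=
  #|[set y | adj G x y]|.

Definition regular (V : finType) (r : nat) (G : sgraph V) : Prop :=
  forall x : V, degree G x = r.

(* Sharing the vertex type V makes a subgraph F of G spanning. Degrees are
   natural numbers, so only the nonnegative elements of H matter. *)
Definition is_factor (V : finType) (H : {pred nat}) (G F : sgraph V) : Prop :=
  subrel (adj F) (adj G) /\ forall x : V, degree F x \in H.

Definition has_factor (V : finType) (H : {pred nat}) (G : sgraph V) : Prop :=
  exists F : sgraph V, is_factor H G F.

(* Main.v *)
Require Import Defs.
From mathcomp Require Import all_boot.

(** The graph is the complete graph on r + 1 vertices. As r is even and k is
    odd, both k and r - k are odd, while the number r + 1 of vertices is odd
    too; so a factor with all degrees in {k, r - k} would have an odd degree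
    sum. This contradicts the handshake lemma [odd_sum_degree]. *)

Lemma degreeE (V : finType) (G : sgraph V) (x : V) :
  degree G x = \sum_y adj G x y.
Proof. by rewrite /degree cardsE -sum1_card big_mkcond. Qed.

(** Each edge joins two distinct vertices, so ordering the vertices (here by
    [enum_rank]) splits the pairs of adjacent vertices into the increasing and
    the decreasing ones, and symmetry exchanges the two kinds. *)
Lemma odd_sum_degree (V : finType) (G : sgraph V) :
  odd (\sum_x degree G x) = false.
Proof.
pose up x y : nat := adj G x y && (enum_rank x < enum_rank y).
have degE x : degree G x = \sum_y up x y + \sum_y up y x.
  rewrite degreeE -big_split; apply: eq_bigr => y _.
  rewrite /up (adj_sym G y x).
  case: ltngtP => [||/val_inj/enum_rank_inj->]; rewrite ?adj_irr //;
    by case: (adj G x y).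
rewrite (eq_bigr _ (fun x _ => degE x)) big_split /=.
by rewrite [X in _ + X]exchange_big addnn odd_double.
Qed.

Lemma odd_degrees_even_card {V : finType} {F : sgraph V} :
  (forall x, odd (degree F x)) -> ~~ odd #|V|.
Proof.
move=> odd_deg; have := odd_sum_degree V F.
rewrite (big_morph odd oddD (erefl : odd 0 = false)).
rewrite (eq_bigr (fun=> odd 1)) => [|x _]; last by rewrite odd_deg.
by rewrite -(big_morph odd oddD (erefl : odd 0 = false)) sum1_card => ->.
Qed.

Definition complete_graph (V : finType) : sgraph V :=
  SGraph (adj := fun x y => x != y)
    (fun x y => congr1 negb (eq_sym x y)) (fun x => negbF (eqxx x)).

Lemma degree_complete_graph (V : finType) (x : V) :
  degree (complete_graph V) x = #|V|.-1.
Proof.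
rewrite -(cardsC1 x); apply: eq_card => y.
by rewrite !inE eq_sym.
Qed.

Theorem theorem2p3 (r k : nat) (r_gt0 : 0 < r) (k_gt0 : 0 < k)
  (r_even : ~~ odd r) (k_odd : odd k) (k_bounds : 1 <= k <= r %/ 2 - 1) :
  exists (V : finType) (G : sgraph V),
    regular r G /\ ~ has_factor (pred2 k (r - k)) G.
Proof.
have k_le_r : k <= r.
  case/andP: k_bounds => _ /leq_trans; apply.
  exact: leq_trans (leq_subr _ _) (leq_div _ _).
exists 'I_r.+1, (complete_graph 'I_r.+1); split=> [x | [F [_ degF]]].
  by rewrite degree_complete_graph card_ord.
suff odd_degF x : odd (degree F x).
  by have := odd_degrees_even_card odd_degF; rewrite card_ord /= r_even.
have /orP[] := degF x => /eqP->; first exact: k_odd.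
by rewrite oddB // (negPf r_even) k_odd.
Qed.
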